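(* $\mathbb{R}$ (the set of minimal rational Cauchy filters) with addition and multiplication, and with the ordering $<$, is an ordered field: it is a field, $<$ is a strict total ordering on it, and for all $a,b,c\in\mathbb{R}$ with $a\le b$ one has $a+c\le b+c$ and, if $c>0$, also $ac\le bc$.
   Context: For $q\in\mathbb{Q}$ and rational $\varepsilon>0$ let $q_\varepsilon=\{x\in\mathbb{Q}\mid q-\varepsilon<x<q+\varepsilon\}$. A (rational) filter is a non-empty collection $\mathcal{F}$ of subsets of $\mathbb{Q}$ closed under binary intersections and under supersets (in $\mathbb{Q}$); the improper filter $\mathcal{P}(\mathbb{Q})$ is allowed as a filter. A filter $\mathcal{F}$ is Cauchy if for every rational $\varepsilon>0$ there is $q\in\mathbb{Q}$ with $q_\varepsilon\in\mathcal{F}$. A minimal Cauchy filter is a Cauchy filter $\mathcal{F}$ such that any Cauchy filter $\mathcal{G}\subseteq\mathcal{F}$ satisfies $\mathcal{G}=\mathcal{F}$. In this statement $\mathbb{R}$ denotes the set of all minimal Cauchy filters in $\mathbb{Q}$, and its elements are called real numbers. For $A,B\subseteq\mathbb{Q}$ write $A<_\forall B$ if $\alpha<\beta$ for all $\alpha\in A$ and $\beta\in B$. For real numbers $a,b$, $a<b$ means that there exist $A\in a$ and $B\in b$ with $A<_\forall B$; $a\le b$ means $a<b$ or $a=b$. For $A,B\subseteq\mathbb{Q}$ let $A+B=\{\alpha+\beta\mid\alpha\in A,\beta\in B\}$ and $AB=\{\alpha\beta\mid\alpha\in A,\beta\in B\}$. For real numbers $a,b$, the sum $a+b$ is the collection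 of all $C\subseteq\mathbb{Q}$ such that $C\supseteq A+B$ for some $A\in a$, $B\in b$; the product $ab$ is the collection of all $C\subseteq\mathbb{Q}$ such that $C\supseteq AB$ for some $A\in a$, $B\in b$. These are regarded as binary operations on $\mathbb{R}$. The real number $0$ is $\iota(0)=\{S\subseteq\mathbb{Q}\mid 0_\varepsilon\subseteq S\text{ for some rational }\varepsilon>0\}$. *)

(* Defs.v *)
From HB Require Import structures.
From mathcomp Require Import all_boot all_order all_algebra.
From mathcomp Require Import boolp classical_sets filter.
Set Implicit Arguments.
Unset Strict Implicit.
Unset Printing Implicit Defensive.
Import Order.TTheory GRing.Theory Num.Theory.
Local Open Scope classical_set_scope.
Local Open Scope ring_scope.

Definition rat_ball (q eps : rat) : set rat :=
  [set x | q - eps < x < q + eps].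

(* [Filter] does not require properness: the improper filter [setT] is allowed. *)
Definition cauchy_filter (F : set_system rat) : Prop :=
  Filter F /\ forall eps : rat, 0 < eps -> exists q : rat, F (rat_ball q eps).

Definition minimal_cauchy_filter (F : set_system rat) : Prop :=
  cauchy_filter F /\
  forall G : set_system rat, cauchy_filter G -> G `<=` F -> G = F.

Definition real : Type :=
  set_type [set F : set_system rat | minimal_cauchy_filter F].

Definition real_filter (a : real) : set_system rat := val a.

Definition add_filter (F G : set_system rat) : set_system rat :=
  [set C | exists A B : set rat,
     [/\ F A, G B & [set x + y | x in A & y in B] `<=` C]].

Definition mul_filter (F G : set_system rat) : set_system rat :=
  [set C | exists A B : set rat,
     [/\ F A, G B & [set x * y | x in A & y in B] `<=` C]].

Definition zero_filter : set_system rat :=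
  [set S | exists eps : rat, 0 < eps /\ rat_ball 0 eps `<=` S].

Definition set_lt (A B : set rat) : Prop :=
  forall x y : rat, A x -> B y -> x < y.

Definition real_lt (a b : real) : Prop :=
  exists A B : set rat, [/\ real_filter a A, real_filter b B & set_lt A B].

Definition real_le (a b : real) : Prop := real_lt a b \/ a = b.

(* Main.v *)
Require Import Defs.
From HB Require Import structures.
From mathcomp Require Import all_boot all_order all_algebra.
From mathcomp Require Import boolp classical_sets filter.
From mathcomp Require Import reals Rstruct lra.
Set Implicit Arguments.
Unset Strict Implicit.
Unset Printing Implicit Defensive.
Import Order.TTheory GRing.Theory Num.Theory.
Local Open Scope classical_set_scope.
Local Open Scope ring_scope.

(* The minimal rational Cauchy filters are exactly the traces on
   [rat] of the neighbourhood filters of the points of a complete ordered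
   field: every proper Cauchy filter contains the trace at the supremum of the
   rationals [q] such that the filter contains the ray above [q], and the traces
   at two distinct points are incomparable.  Under this bijection the sum, the
   product and the order of filters become those of the complete field. *)

(** * Transport of a field structure along a bijection *)

Lemma transport_field (F : fieldType) (T : Type) (f : F -> T)
    (g : T -> F) :
  cancel f g -> cancel g f ->
  exists K : GRing.Field T,
    let R : fieldType := GRing.Field.Pack K in
    [/\ forall a b : R, a + b = f (g a + g b),
        forall a b : R, a * b = f (g a * g b)
      & (0 : R) = f 0].
Proof.
move=> fK gK.
(* Equality and choice on the bare type [T] are classical; the field laws then reduce to those of
   [F] by cancelling [g] against [f]. *)
pose emixin := gen_eqMixin T; pose chmixin := gen_choiceMixin T.
pose C : choiceType := HB.pack T emixin chmixin.
pose add a b := f (g a + g b); pose mul a b := f (g a * g b).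
have addA : associative add by move=> a b c; rewrite /add !fK addrA.
have addC : commutative add by move=> a b; rewrite /add addrC.
have add0 : left_id (f 0) add by move=> a; rewrite /add fK add0r gK.
have addN : left_inverse (f 0) (fun a => f (- g a)) add.
  by move=> a; rewrite /add fK addNr.
have mulA : associative mul by move=> a b c; rewrite /mul !fK mulrA.
have mulC : commutative mul by move=> a b; rewrite /mul mulrC.
have mul1 : left_id (f 1) mul by move=> a; rewrite /mul fK mul1r gK.
have mulD : left_distributive mul add.
  by move=> a b c; rewrite /mul /add !fK mulrDl.
have neq10 : f 1 != f 0 :> C by rewrite (can_eq (fK : cancel (f : F -> C) g)) oner_eq0.
have mulV a : (a : C) != f 0 -> mul (f (g a)^-1) a = f 1.
  move=> a0; rewrite /mul fK mulVf //.
  by apply: contraNneq a0 => <-; rewrite gK.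
(* Inversion is total, with value zero at zero. *)
have inv0 : f (g (f 0))^-1 = f 0 by rewrite fK invr0.
pose zmixin := GRing.isZmodule.Build C addA addC add0 addN.
pose Z : zmodType := HB.pack T emixin chmixin zmixin.
pose rmixin := GRing.Zmodule_isComNzRing.Build Z mulA mulC mul1 mulD neq10.
pose A : comNzRingType := HB.pack T emixin chmixin zmixin rmixin.
pose fmixin := GRing.ComNzRing_isField.Build A mulV inv0.
pose K : fieldType := HB.pack T emixin chmixin zmixin rmixin fmixin.
by exists (GRing.Field.class K).
Qed.

(** * Traces of neighbourhood filters on the rationals *)

Definition rat_nbhs (R : realType) (x : R) : set_system rat :=
  [set S | exists2 e : R, 0 < e & forall q : rat, `|ratr q - x| < e -> S q].

Lemma rat_nbhs_filter (R : realType) (x : R) : Filter (rat_nbhs x).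
Proof.
split.
- by exists 1.
- move=> A B [d d0 dA] [e e0 eB]; exists (Num.min d e); first by rewrite lt_min d0.
  by move=> q; rewrite lt_min => /andP[qd qe]; split; [exact: dA|exact: eB].
- by move=> A B AB [d d0 dA]; exists d => // q /dA /AB.
Qed.

(** By density, [q] can be taken on the side of [x] facing away from zero. The bound [|x| < |q|]
    makes [q] a safe divisor in the product estimate. *)
Lemma exists_rat_away (R : realType) (x d : R) : 0 < d ->
  exists q : rat, `|ratr q - x| < d /\ `|x| < `|ratr q : R|.
Proof.
move=> d0; have [x0|x0] := leP 0 x.
- have /rat_in_itvoo[q] : x < x + d by rewrite ltrDl.
  rewrite in_itv /= => /andP[xq qd]; exists q.
  by rewrite (ger0_norm x0) !gtr0_norm; lra.
- have /rat_in_itvoo[q] : x - d < x by rewrite ltrBlDr ltrDl.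
  rewrite in_itv /= => /andP[xq qd]; exists q.
  by rewrite !ltr0_norm; lra.
Qed.

Lemma rat_nbhs_ratP (R : realType) (x : R) (S : set rat) :
  rat_nbhs x S <->
  exists2 e : rat, 0 < e & forall q : rat, `|ratr q - x| < ratr e -> S q.
Proof.
split=> [[e e0 eS]|[e e0 eS]]; last by exists (ratr e); rewrite ?ltr0q.
have /rat_in_itvoo[d] := e0; rewrite in_itv /= => /andP[d0 de].
by exists d; rewrite -?(ltr0q R) // => q qd; apply: eS; apply: lt_trans qd de.
Qed.

Lemma rat_ballE (R : realType) (q e y : rat) :
  rat_ball q e y <-> `|ratr y - ratr q : R| < ratr e.
Proof.
by rewrite ltr_distl -rmorphB -rmorphD !ltr_rat.
Qed.

Lemma rat_nbhs_cauchy (R : realType) (x : R) : cauchy_filter (rat_nbhs x).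
Proof.
split; first exact: rat_nbhs_filter.
move=> e e0; have re0 : (0 : R) < ratr e / 2 by rewrite divr_gt0 ?ltr0q.
have [q [qx _]] := exists_rat_away x re0.
exists q, (ratr e / 2) => // y yx; apply/(rat_ballE R).
move: qx yx; rewrite !ltr_norml => /andP[? ?] /andP[? ?]; apply/andP; lra.
Qed.

Lemma rat_nbhs_proper (R : realType) (x : R) : ~ rat_nbhs x set0.
Proof.
by move=> [e e0 eS]; have [q [qx _]] := exists_rat_away x e0; exact: (eS q).
Qed.

(** If [x] and [y] differ, the balls around them with radius half their distance are disjoint, yet
    both would lie in the proper filter at [y]. *)
Lemma rat_nbhs_sub_inj (R : realType) (x y : R) :
  rat_nbhs x `<=` rat_nbhs y -> x = y.
Proof.
move=> xy; apply/eqP/negPn/negP => neq.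
have d0 : 0 < `|x - y| / 2 by rewrite divr_gt0 // normr_gt0 subr_eq0.
pose S z := [set q : rat | `|ratr q - z| < `|x - y| / 2].
have Sx : rat_nbhs y (S x) by apply: xy; exists (`|x - y| / 2).
have Sy : rat_nbhs y (S y) by exists (`|x - y| / 2).
have /= := @filterI _ _ (rat_nbhs_filter y) _ _ Sx Sy.
suff -> : S x `&` S y = set0 by exact: rat_nbhs_proper.
apply/seteqP; split=> // q []; rewrite /S /= (distrC _ x) => qx qy.
have := ler_normD (x - ratr q) (ratr q - y).
by rewrite subrKA; lra.
Qed.

Lemma cauchy_filter_limit (R : realType) (F : set_system rat) :
  cauchy_filter F -> ~ F set0 -> exists x : R, rat_nbhs x `<=` F.
Proof.
move=> [Ffilter Fcauchy] F0.
pose L : set R := [set ratr q | q in [set q : rat | F [set y | q < y]]].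
(* A ball in [F] brackets the supremum of [L]: a ray in [F] starting at or beyond the right end
   would miss the ball, against properness. *)
have Lball q d : F (rat_ball q d) -> L (ratr (q - d)) /\ ubound L (ratr (q + d)).
  move=> Fqd; split.
    by exists (q - d) => //=; apply: filterS Fqd => y /andP[].
  move=> _ [p Fp <-]; rewrite ler_rat leNgt; apply/negP => qp.
  apply: F0; apply: filterS (filterI Fqd Fp) => y [/andP[_ yq]] /= py.
  by have := lt_trans (lt_trans qp py) yq; rewrite ltxx.
have Lsup : has_sup L.
  have [q /Lball[Lq qL]] := Fcauchy 1 ltr01.
  by split; [exists (ratr (q - 1))|exists (ratr (q + 1))].
exists (sup L) => S /rat_nbhs_ratP[e e0 eS].
(* Both [sup L] and the points of this ball are within [e / 2] of [q]. *)
have [|q Fq] := Fcauchy (e / 2); first by rewrite divr_gt0.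
have [Lq qL] := Lball _ _ Fq.
have le1 : ratr (q - e / 2) <= sup L by apply: ub_le_sup => //; case: Lsup.
have le2 : sup L <= ratr (q + e / 2) by apply: ge_sup => //; case: Lsup.
apply: filterS Fq => y /(rat_ballE R) yq; apply: eS.
move: le1 le2 yq; rewrite rmorphB rmorphD /= fmorph_div /= rmorph_nat.
by rewrite !ltr_norml => ? ? /andP[? ?]; apply/andP; lra.
Qed.

(** A Cauchy filter inside a trace is proper, so it contains a trace itself, and incomparability
    makes the two traces equal. *)
Lemma rat_nbhs_minimal (R : realType) (x : R) :
  minimal_cauchy_filter (rat_nbhs x).
Proof.
split=> [|G Gc Gx]; first exact: rat_nbhs_cauchy.
have [|y yG] := @cauchy_filter_limit R G Gc.
  by move=> /Gx; exact: rat_nbhs_proper.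
have yx : y = x by apply: rat_nbhs_sub_inj => S /yG /Gx.
by apply/seteqP; split=> //; rewrite -yx.
Qed.

Lemma minimal_cauchy_filterP (R : realType) (F : set_system rat) :
  minimal_cauchy_filter F -> exists x : R, rat_nbhs x = F.
Proof.
move=> [Fc Fmin].
have [|x xF] := @cauchy_filter_limit R F Fc; last first.
  by exists x; apply: Fmin => //; exact: rat_nbhs_cauchy.
(* The improper filter contains the trace at 0, so minimality would make that proper trace
   improper. *)
move=> F0; apply: (@rat_nbhs_proper R 0).
rewrite (Fmin (rat_nbhs (0 : R))) //; first exact: rat_nbhs_cauchy.
by move=> S _; case: Fc => ? _; apply: filterS F0.
Qed.

(** * Zero, sums and products of traces *)

Lemma zero_filterE (R : realType) : zero_filter = rat_nbhs (0 : R).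
Proof.
apply/seteqP; split=> S.
- move=> [e [e0 eS]]; apply/rat_nbhs_ratP; exists e => // q qe.
  by apply/eS/(rat_ballE R); rewrite rmorph0.
- move=> /rat_nbhs_ratP[e e0 eS]; exists e; split=> // q /(rat_ballE R).
  by rewrite rmorph0; exact: eS.
Qed.

Lemma add_filterE (R : realType) (x y : R) :
  add_filter (rat_nbhs x) (rat_nbhs y) = rat_nbhs (x + y).
Proof.
apply/seteqP; split=> S.
- move=> [A [B [[d d0 dA] [e e0 eB] ABS]]].
  exists e => // z zxy.
  (* The second bound is the slack within which moving [q] off [x] keeps [z - q] within [e] of
     [y]. *)
  have m0 : 0 < Num.min d (e - `|ratr z - (x + y)|) by rewrite lt_min d0 subr_gt0.
  have [q [+ _]] := exists_rat_away x m0.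
  rewrite lt_min => /andP[qd qe].
  apply: ABS; exists q; first exact: dA.
  exists (z - q); last by rewrite addrC subrK.
  apply: eB; rewrite rmorphB /=.
  have := ler_normD (ratr z - (x + y)) (x - ratr q).
  rewrite (distrC x) (_ : _ + (x - _) = ratr z - ratr q - y); last by lra.
  lra.
- move=> [e e0 eS].
  exists [set q | `|ratr q - x| < e / 2], [set q | `|ratr q - y| < e / 2].
  split; [by exists (e / 2); rewrite ?divr_gt0..|].
  move=> _ [p px] [q qy] <-; apply: eS; rewrite rmorphD /=.
  have := ler_normD (ratr p - x) (ratr q - y).
  rewrite addrACA -opprD /=; move: px qy => /=; lra.
Qed.

Lemma mul_filterC (F G : set_system rat) : mul_filter F G = mul_filter G F.
Proof.
suff sub F' G' : mul_filter F' G' `<=` mul_filter G' F' by apply/seteqP.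
move=> S [A [B [FA GB ABS]]]; exists B, A; split=> // _ [b Bb] [a Aa] <-.
by apply: ABS; exists a => //; exists b => //; rewrite mulrC.
Qed.

(* For [z] near [x * y], choose [q] in [A] close to [x] with [|x| < |q|]: then
   [z / q] is close to [y], provided that [y] vanishes when [x] does. *)
Lemma mul_filter_sub (R : realType) (x y : R) : (x = 0 -> y = 0) ->
  mul_filter (rat_nbhs x) (rat_nbhs y) `<=` rat_nbhs (x * y).
Proof.
move=> xy0 S [A [B [[d d0 dA] [e e0 eB] ABS]]].
(* If [q] is within [c] of [x], then [|q - x| |y| <= c |y| <= e |x| < e |q|], which leaves a
   positive radius for [z]. *)
have [c c0 cxy] : exists2 c : R, 0 < c & c * `|y| <= e * `|x|.
  have [x0|xn0] := eqVneq x 0.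
    by exists 1; rewrite ?xy0 // x0 normr0 !mulr0.
  have y1 : 0 < `|y| + 1 by rewrite ltr_wpDl.
  have ex0 : 0 < e * `|x| by rewrite mulr_gt0 ?normr_gt0.
  exists (e * `|x| / (`|y| + 1)); first by rewrite divr_gt0.
  rewrite mulrAC ler_pdivrMr // ler_wpM2l ?ltW //; lra.
have m0 : 0 < Num.min d c by rewrite lt_min d0.
have [q [+ xq]] := exists_rat_away x m0.
rewrite lt_min => /andP[qd qc].
have q0 : 0 < `|ratr q : R| by apply: le_lt_trans xq.
have qn0 : (ratr q : R) != 0 by rewrite -normr_gt0.
have qn0' : q != 0 by move: qn0; rewrite fmorph_eq0.
have lt_e : `|ratr q - x| * `|y| < e * `|ratr q : R|.
  apply: (@le_lt_trans _ _ (c * `|y|)); first by rewrite ler_wpM2r // ltW.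
  by apply: le_lt_trans cxy _; rewrite ltr_pM2l.
exists (e * `|ratr q| - `|ratr q - x| * `|y|); first by rewrite subr_gt0.
move=> z zxy; apply: ABS; exists q; first exact: dA.
exists (z / q); last by rewrite mulrC divfK.
apply: eB; rewrite fmorph_div /=.
have -> : ratr z / ratr q - y = (ratr z - ratr q * y) / ratr q :> R.
  by rewrite mulrBl (mulrC (ratr q)) mulfK.
rewrite normrM normfV ltr_pdivrMr //.
have := ler_normD (ratr z - x * y) ((x - ratr q) * y).
rewrite normrM (distrC x) mulrBl subrKA; lra.
Qed.

Lemma mul_filterE (R : realType) (x y : R) :
  mul_filter (rat_nbhs x) (rat_nbhs y) = rat_nbhs (x * y).
Proof.
apply/seteqP; split.
  (* The side condition of [mul_filter_sub] is vacuous for nonzero [x]; for [x = 0], swapping the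
     factors turns it into [y = 0 -> x = 0]. *)
  have [x0|xn0] := eqVneq x 0; last first.
    by apply: mul_filter_sub => x0; rewrite x0 eqxx in xn0.
  by rewrite mul_filterC mulrC; exact: mul_filter_sub.
move=> S [e e0 eS].
have K0 : 0 < `|x| + `|y| + 1 by rewrite ltr_wpDl // addr_ge0.
(* In the expansion of [p q - x y] around [(x, y)], [d <= 1] bounds the quadratic term by [d], so
   the total stays below [d (|x| + |y| + 1) <= e]. *)
pose d := Num.min 1 (e / (`|x| + `|y| + 1)).
have d0 : 0 < d by rewrite lt_min ltr01 divr_gt0.
have d1 : d <= 1 by rewrite ge_min lexx.
have de : d * (`|x| + `|y| + 1) <= e.
  by rewrite -ler_pdivlMr // ge_min lexx orbT.
exists [set q | `|ratr q - x| < d], [set q | `|ratr q - y| < d].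
split; [by exists d..|].
move=> _ [p px] [q qy] <-; apply: eS; rewrite rmorphM /=.
have -> : ratr p * ratr q - x * y =
    (ratr p - x) * (ratr q - y) + (x * (ratr q - y) + (ratr p - x) * y) :> R.
  by rewrite !mulrBl !mulrBr; lra.
apply: le_lt_trans (ler_normD _ _) _.
apply: le_lt_trans (lerD (lexx _) (ler_normD _ _)) _.
rewrite !normrM; apply: lt_le_trans de.
have h1 : `|ratr p - x| * `|ratr q - y| < d.
  apply: (@le_lt_trans _ _ (`|ratr p - x| * 1)); last by rewrite mulr1.
  by rewrite ler_wpM2l //; apply: le_trans (ltW qy) d1.
have h2 : `|x| * `|ratr q - y| <= `|x| * d by rewrite ler_wpM2l // ltW.
have h3 : `|ratr p - x| * `|y| <= d * `|y| by rewrite ler_wpM2r // ltW.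
by rewrite !mulrDr mulr1 (mulrC d `|x|); lra.
Qed.

(** * The order of traces *)

Lemma rat_nbhs_ltP (R : realType) (x y : R) :
  (exists A B : set rat, [/\ rat_nbhs x A, rat_nbhs y B & set_lt A B]) <-> x < y.
Proof.
split=> [[A [B [[d d0 dA] [e e0 eB] AB]]]|xy]; last first.
  have d0 : 0 < (y - x) / 2 by rewrite divr_gt0 // subr_gt0.
  exists [set q | `|ratr q - x| < (y - x) / 2].
  exists [set q | `|ratr q - y| < (y - x) / 2].
  split; [by exists ((y - x) / 2)..|move=> p q /=].
  rewrite !ltr_norml -(ltr_rat R) => /andP[? ?] /andP[? ?]; lra.
(* If [y <= x], a rational [p] of [A] just above [x] exceeds a rational [q] of [B] just below
   [y]. *)
rewrite ltNge; apply/negP => yx.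
have /rat_in_itvoo[p] : x < x + d by rewrite ltrDl.
have /rat_in_itvoo[q] : y - e < y by rewrite ltrBlDr ltrDl.
rewrite !in_itv /= => /andP[q1 q2] /andP[p1 p2].
have : p < q.
  apply: AB; [apply: dA|apply: eB]; rewrite ltr_norml; apply/andP; lra.
by rewrite -(ltr_rat R); lra.
Qed.

(** * The bijection with a complete ordered field, and the conclusion *)

Definition real_of (R : realType) (x : R) : real :=
  exist _ (rat_nbhs x) (mem_set (rat_nbhs_minimal x)).

Lemma real_of_bij (R : realType) :
  exists2 g : real -> R, cancel (@real_of R) g & cancel g (@real_of R).
Proof.
(* Surjectivity yields a section by choice; injectivity of traces makes it a two-sided inverse. *)
have /choice[g gP] (a : real) : exists x : R, real_of x = a.
  have [x xa] := minimal_cauchy_filterP R (set_mem (valP a)).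
  by exists x; apply: val_inj.
exists g => // x; apply: rat_nbhs_sub_inj.
by rewrite (congr1 val (gP (real_of x)) : rat_nbhs _ = rat_nbhs _).
Qed.

(* The set [real] carries a field structure whose addition, multiplication and
   zero are those of the filters, and [real_lt] makes it an ordered field. *)
Theorem theorem4p26 :
  exists real_field : GRing.Field real,
  let R : fieldType := GRing.Field.Pack real_field in
  [/\ [/\ forall a b : R,
            real_filter (a + b) = add_filter (real_filter a) (real_filter b),
          forall a b : R,
            real_filter (a * b) = mul_filter (real_filter a) (real_filter b)
        & real_filter (0 : R) = zero_filter],
      [/\ forall a : real, ~ real_lt a a,
          forall a b c : real, real_lt a b -> real_lt b c -> real_lt a c
        & forall a b : real, [\/ real_lt a b, a = b | real_lt b a]]
    & forall a b c : R, real_le a b ->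
        real_le (a + c) (b + c) /\
        (real_lt (0 : R) c -> real_le (a * c) (b * c))].
Proof.
(* The reals of the standard library serve as the complete ordered field. *)
pose F : realType := Rdefinitions.R.
have [g fK gK] := real_of_bij F.
have [K [addE mulE zeroE]] := @transport_field F real (@real_of F) g fK gK.
have filterE a : real_filter a = rat_nbhs (g a) by rewrite -{1}(gK a).
have ltP a b : real_lt a b <-> g a < g b.
  by rewrite /real_lt !filterE; exact: rat_nbhs_ltP.
have leP a b : real_le a b <-> g a <= g b.
  rewrite le_eqVlt; split=> [[/ltP->|->]|/orP[/eqP/(can_inj gK)|/ltP]].
  - by rewrite orbT.
  - by rewrite eqxx.
  - by right.
  - by left.
exists K; split.
- split=> [a b|a b|].
  + by rewrite addE !filterE fK add_filterE.
  + by rewrite mulE !filterE fK mul_filterE.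
  + by rewrite zeroE filterE fK (zero_filterE F).
- split=> [a /ltP|a b c /ltP ab /ltP bc|a b].
  + by rewrite ltxx.
  + by apply/ltP; exact: lt_trans bc.
  + have [ab|ba|/(can_inj gK)] := ltgtP (g a) (g b).
    * by constructor 1; apply/ltP.
    * by constructor 3; apply/ltP.
    * by constructor 2.
- move=> a b c /leP ab; split=> [|/ltP]; last rewrite zeroE fK => c0.
  + by apply/leP; rewrite !addE !fK lerD2r.
  + by apply/leP; rewrite !mulE !fK ler_wpM2r // ltW.
Qed.
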